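(* Let $G$ be a group and $X \subseteq \mathbb{N}$. Then the quotient $G/\mathrm{Tor}^{X}_{\omega}(G)$ is $X$-torsion-free.
   Context: For a group $G$ and $X \subseteq \mathbb{N}$, the $X$-torsion of $G$ is $\mathrm{Tor}^{X}(G) := \{ g \in G \mid \exists n \in X \text{ with } g^{n} = e\}$, and $G$ is $X$-torsion-free if $\mathrm{Tor}^{X}(G) = \{e\}$. Define inductively $\mathrm{Tor}^{X}_{0}(G) := \{e\}$, $\mathrm{Tor}^{X}_{n+1}(G) := \langle\langle \{ g \in G \mid g\,\mathrm{Tor}^{X}_{n}(G) \in \mathrm{Tor}^{X}(G/\mathrm{Tor}^{X}_{n}(G))\} \rangle\rangle^{G}$ (normal closure in $G$), and $\mathrm{Tor}^{X}_{\omega}(G) := \bigcup_{n \in \mathbb{N}} \mathrm{Tor}^{X}_{n}(G)$. *)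

(* Defs.v *)
Set Implicit Arguments.

Record Group := {
  carrier :> Type;
  mul : carrier -> carrier -> carrier;
  inv : carrier -> carrier;
  one : carrier;
  mulA : forall x y z, mul x (mul y z) = mul (mul x y) z;
  mul1g : forall x, mul one x = x;
  mulg1 : forall x, mul x one = x;
  mulVg : forall x, mul (inv x) x = one;
  mulgV : forall x, mul x (inv x) = one
}.

Section Defs.
Variable G : Group.

Fixpoint gpow (g : G) (n : nat) : G :=
  match n with O => one G | S k => mul G g (gpow g k) end.

Definition is_subgroup (H : G -> Prop) : Prop :=
  H (one G) /\ (forall x y, H x -> H y -> H (mul G x y)) /\
  (forall x, H x -> H (inv G x)).

Definition is_normal (N : G -> Prop) : Prop :=
  is_subgroup N /\ forall g x, N x -> N (mul G (mul G g x) (inv G g)).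

Definition normal_closure (S : G -> Prop) : G -> Prop :=
  fun x => forall N, is_normal N -> (forall y, S y -> N y) -> N x.

(* For a normal subgroup N: g N lies in Tor^X(G/N), i.e. (gN)^n = N for some
   n in X, i.e. g^n \in N. *)
Definition quot_torsion (X : nat -> Prop) (N : G -> Prop) (g : G) : Prop :=
  exists n, X n /\ N (gpow g n).

Fixpoint TorX (X : nat -> Prop) (n : nat) : G -> Prop :=
  match n with
  | O => fun x => x = one G
  | S k => normal_closure (quot_torsion X (TorX X k))
  end.

Definition TorX_omega (X : nat -> Prop) : G -> Prop :=
  fun x => exists n, TorX X n x.

(* G/N is X-torsion-free: Tor^X(G/N) = {N}, i.e. every coset gN with
   (gN)^n = N for some n in X is the trivial coset, i.e. g \in N. *)
Definition quotient_X_torsion_free (X : nat -> Prop) (N : G -> Prop) : Prop :=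
  forall g, quot_torsion X N g -> N g.

End Defs.

(* Main.v *)
Require Import Defs.

Lemma normal_closure_of_mem (G : Group) (S : G -> Prop) (x : G) :
  S x -> normal_closure G S x.
Proof. intros Sx N _ SN. exact (SN x Sx). Qed.

Lemma TorX_succ_of_quot_torsion (G : Group) (X : nat -> Prop) (k : nat) (g : G) :
  quot_torsion G X (TorX G X k) g -> TorX G X (S k) g.
Proof. exact (normal_closure_of_mem G (quot_torsion G X (TorX G X k)) g). Qed.

Theorem lemma2p2 (G : Group) (X : nat -> Prop) :
  @quotient_X_torsion_free G X (@TorX_omega G X).
Proof.
  intros g [n [Xn [k gn_in_TorX_k]]].
  exists (S k).
  apply TorX_succ_of_quot_torsion.
  exists n. split; assumption.
Qed.
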